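(* Let $\alpha>1$, $\delta\in(0,\alpha-1)$, $\tau\in(0,\alpha-1-\delta]$, $d\in\mathbb N$, $1\ge\gamma_1\ge\dots\ge\gamma_d>0$, and $g\in\mathcal A_{\alpha,\boldsymbol\gamma,d}$. Let $\boldsymbol x_1,\dots,\boldsymbol x_N\in[0,1]^d$, $c_1,\dots,c_N\in\mathbb R$. Let $L$ be a prime and $\mathcal Z=\{\boldsymbol z_0,\dots,\boldsymbol z_{L-1}\}$ a rank-1 lattice point set of size $L$ satisfying $e(H_{\beta,\boldsymbol\gamma,d},\mathcal Z)\le C_{\boldsymbol\gamma,d}(\beta,\tau')L^{-\beta+\tau'}$ for all $\tau'\in(0,\beta-\frac12]$, where $\beta=\alpha-\frac12-\delta$. Then for $\nu>1$, with $K=R^\alpha_{\nu,\boldsymbol\gamma,d}$, $$\Big|\frac1N\sum_{n=1}^Nc_ng(\boldsymbol x_n)-\frac1L\sum_{\ell=0}^{L-1}g(\boldsymbol z_\ell)\phi_K(\boldsymbol z_\ell)\Big|\le\mathrm{err}_1(g,\mathcal C)+\mathrm{err}_2(g,\mathcal C)\le\|g\|_{\mathcal A_{\alpha,\boldsymbol\gamma,d}}\Big[\frac1{\sqrt\nu}+\frac{\nu^{d/2}}{L^{\alpha-\frac12-\delta-\tau}}c_{\alpha,\boldsymbol\gamma,d}\,\zeta_{\delta,d}\,C_{\boldsymbol\gamma,d}\big(\alpha-\tfrac12-\delta,\tau\big)\Big]\overline\mu_N.$$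
   Context: $r_\beta(\gamma,h)=\max(|h|^{2\beta}/\gamma,1)$, $r_\beta(\boldsymbol\gamma,\boldsymbol k)=\prod_jr_\beta(\gamma_j,k_j)$; $\omega_{\boldsymbol k}(\boldsymbol x)=\exp(2\pi i\,\boldsymbol k\cdot\boldsymbol x)$, $\widehat f_{\boldsymbol k}=\int_{[0,1]^d}f\,\overline{\omega_{\boldsymbol k}}$. $\mathcal A_{\alpha,\boldsymbol\gamma,d}=\{f\in L_1([0,1]^d):\|f\|_{\mathcal A_{\alpha,\boldsymbol\gamma,d}}=\sum_{\boldsymbol k}\sqrt{r_\alpha(\boldsymbol\gamma,\boldsymbol k)}|\widehat f_{\boldsymbol k}|<\infty\}$; $H_{\beta,\boldsymbol\gamma,d}=\{f\in L_2:\|f\|^2_{H_{\beta,\boldsymbol\gamma,d}}=\sum_{\boldsymbol k}r_\beta(\boldsymbol\gamma,\boldsymbol k)|\widehat f_{\boldsymbol k}|^2<\infty\}$. Weighted $d$-dimensional rectangle: $R^\alpha_{\nu,\boldsymbol\gamma,d}=\{\boldsymbol k\in\mathbb Z^d:\max_{j}r_\alpha(\gamma_j,k_j)\le\nu\}$. $\phi_K(\boldsymbol x)=\sum_{\boldsymbol k\in K}\check\phi_{\boldsymbol k}\overline{\omega_{\boldsymbol k}(\boldsymbol x)}$, $\check\phi_{\boldsymbol k}=\frac1N\sum_nc_n\omega_{\boldsymbol k}(\boldsymbol x_n)$; $\mathcal C=(c_n)$; $\mathrm{err}_1(g,\mathcal C)=|\frac1N\sum_nc_ng(\boldsymbol x_n)-\int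 g\phi_K|$, $\mathrm{err}_2(g,\mathcal C)=|\int g\phi_K-\frac1L\sum_\ell(g\phi_K)(\boldsymbol z_\ell)|$. Rank-1 lattice of size $L$: $\{\boldsymbol z_\ell=(\ell\mathfrak g/L)\bmod1\}$, $\mathfrak g\in\{1,\dots,L-1\}^d$. $e(H_{\beta,\boldsymbol\gamma,d},\mathcal Z)=\sup_{\|f\|\le1}|\int f-\frac1L\sum_\ell f(\boldsymbol z_\ell)|$. $C_{\boldsymbol\gamma,d}(\beta,\tau)=2^{\beta-\tau}\prod_j[1+2\gamma_j^{1/(2(\beta-\tau))}\zeta(\frac\beta{\beta-\tau})]^{\beta-\tau}$; $\overline\mu_N=\frac1N\sum_n|c_n|$; $c_{\alpha,\boldsymbol\gamma,d}=\sqrt{\prod_j\max(1,2^{2\alpha}\gamma_j)}$; $\zeta_{\delta,d}=[1+2\zeta(1+2\delta)]^{d/2}$; $\zeta$ Riemann zeta. *)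

(* Defs.v *)
From HB Require Import structures.
From mathcomp Require Import all_boot all_order all_algebra.
From mathcomp Require Import all_classical all_reals all_analysis.
From mathcomp Require Import complex.
Set Implicit Arguments. Unset Strict Implicit. Unset Printing Implicit Defensive.
Import Order.TTheory GRing.Theory Num.Theory.
Import numFieldNormedType.Exports.
Local Open Scope classical_set_scope.
Local Open Scope ring_scope.
Local Open Scope complex_scope.

Section Defs.
Variable R : realType.

(* points of [0,1]^d are functions 'I_d -> R, frequencies are k : {ffun 'I_d -> int} *)
Definition unit_cube (d : nat) : set ('I_d -> R) :=
  [set x | forall i, 0 <= x i <= 1].

(* prepend a first coordinate *)
Definition ocons (d : nat) (t : R) (y : 'I_d -> R) : 'I_d.+1 -> R :=
  fun i => if unlift ord0 i is Some j then y j else t.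

(* Lebesgue integral over [0,1]^d of a real function, as an iterated
   Lebesgue integral (equal to the integral for the product measure on
   integrable functions by Fubini). For d = 0 the cube is a point. *)
Fixpoint cube_int (d : nat) : (('I_d -> R) -> R) -> R :=
  match d return (('I_d -> R) -> R) -> R with
  | 0 => fun f => f (fun _ => 0)
  | d'.+1 => fun f =>
      (\int[lebesgue_measure]_(t in `[0%R, 1%R]) cube_int (fun y => f (ocons t y)))%R
  end.

(* integral of a complex function over [0,1]^d *)
Definition cint (d : nat) (f : ('I_d -> R) -> R[i]) : R[i] :=
  (cube_int (fun x => complex.Re (f x))) +i* (cube_int (fun x => complex.Im (f x))).

(* modulus of a complex number *)
Definition cabs (z : R[i]) : R := Num.sqrt (complex.Re z ^+ 2 + complex.Im z ^+ 2).

Definition dotk (d : nat) (k : {ffun 'I_d -> int}) (x : 'I_d -> R) : R :=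
  \sum_(j < d) (k j)%:~R * x j.

(* omega_k(x) = exp(2 pi i k.x) *)
Definition omega (d : nat) (k : {ffun 'I_d -> int}) (x : 'I_d -> R) : R[i] :=
  (cos (2 * pi * dotk k x)) +i* (sin (2 * pi * dotk k x)).

(* Fourier coefficient  \hat f_k = \int f conj(omega_k) *)
Definition fcoef (d : nat) (f : ('I_d -> R) -> R[i]) (k : {ffun 'I_d -> int}) : R[i] :=
  cint (fun x => f x * (omega k x)^*).

(* r_beta(gamma,h) = max(|h|^(2 beta)/gamma, 1) and its product version *)
Definition r1 (beta gam : R) (h : int) : R :=
  Num.max ((`|h|%:~R) `^ (2 * beta) / gam) 1.
Definition rprod (d : nat) (beta : R) (gam : 'I_d -> R) (k : {ffun 'I_d -> int}) : R :=
  \prod_(j < d) r1 beta (gam j) (k j).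

(* ||f||_A (extended real, +oo if not finite) *)
Definition Anorm (d : nat) (alpha : R) (gam : 'I_d -> R) (f : ('I_d -> R) -> R[i])
  : \bar R :=
  \esum_(k in [set: {ffun 'I_d -> int}]) (Num.sqrt (rprod alpha gam k) * cabs (fcoef f k))%:E.

(* ||f||_H^2 *)
Definition Hnorm2 (d : nat) (beta : R) (gam : 'I_d -> R) (f : ('I_d -> R) -> R[i])
  : \bar R :=
  \esum_(k in [set: {ffun 'I_d -> int}]) (rprod beta gam k * cabs (fcoef f k) ^+ 2)%:E.

(* sum over the box {-M..M}^d *)
Definition boxsum (d M : nat) (F : {ffun 'I_d -> int} -> R[i]) : R[i] :=
  \sum_(u : {ffun 'I_d -> 'I_(2 * M).+1}) F [ffun j => (u j)%:Z - M%:Z].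

(* f coincides on [0,1]^d with its Fourier series (limit of the square
   partial sums); this identifies f with the continuous representative,
   which is how point values of f are understood *)
Definition fourier_rep (d : nat) (f : ('I_d -> R) -> R[i]) : Prop :=
  forall x, unit_cube x ->
    (fun M => complex.Re (boxsum M (fun k => fcoef f k * omega k x))) @ \oo --> complex.Re (f x) /\
    (fun M => complex.Im (boxsum M (fun k => fcoef f k * omega k x))) @ \oo --> complex.Im (f x).

(* rank-1 lattice point z_l = (l g / L) mod 1 *)
Definition lattice_pt (d L : nat) (g : 'I_d -> nat) (l : nat) : 'I_d -> R :=
  fun j => ((l * g j) %% L)%:R / L%:R.

Definition lattice_rule (d L : nat) (g : 'I_d -> nat) (f : ('I_d -> R) -> R[i]) : R[i] :=
  (L%:R)^-1 * \sum_(l < L) f (lattice_pt L g l).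

(* worst-case error e(H_{beta,gamma,d}, Z) *)
Definition wce (d : nat) (beta : R) (gam : 'I_d -> R) (L : nat) (g : 'I_d -> nat) : \bar R :=
  ereal_sup [set (cabs (cint f - lattice_rule L g f))%:E |
             f in [set f | (Hnorm2 beta gam f <= 1)%E /\ fourier_rep f]].

(* Riemann zeta function (s > 1) *)
Definition zeta (s : R) : R := limn (series (riemannR s)).

Definition Cgd (d : nat) (gam : 'I_d -> R) (beta tau : R) : R :=
  2 `^ (beta - tau) *
  \prod_(j < d) (1 + 2 * (gam j) `^ (1 / (2 * (beta - tau))) * zeta (beta / (beta - tau)))
                  `^ (beta - tau).

Definition c_agd (d : nat) (alpha : R) (gam : 'I_d -> R) : R :=
  Num.sqrt (\prod_(j < d) Num.max 1 (2 `^ (2 * alpha) * gam j)).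

Definition zeta_dd (d : nat) (delta : R) : R :=
  (1 + 2 * zeta (1 + 2 * delta)) `^ (d%:R / 2).

(* weighted rectangle R^alpha_{nu,gamma,d} *)
Definition wrect (d : nat) (alpha nu : R) (gam : 'I_d -> R) : set {ffun 'I_d -> int} :=
  [set k | forall j, r1 alpha (gam j) (k j) <= nu].

Definition phi_check (d N : nat) (xs : 'I_N -> 'I_d -> R) (c : 'I_N -> R)
  (k : {ffun 'I_d -> int}) : R[i] :=
  (N%:R)^-1 * \sum_(n < N) (c n)%:C * omega k (xs n).

Definition phiK (d N : nat) (K : set {ffun 'I_d -> int}) (xs : 'I_N -> 'I_d -> R)
  (c : 'I_N -> R) (x : 'I_d -> R) : R[i] :=
  \sum_(k \in K) phi_check xs c k * (omega k x)^*.

Definition err1 (d N : nat) (K : set {ffun 'I_d -> int}) (xs : 'I_N -> 'I_d -> R)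
  (c : 'I_N -> R) (g : ('I_d -> R) -> R[i]) : R :=
  cabs ((N%:R)^-1 * \sum_(n < N) (c n)%:C * g (xs n) - cint (fun x => g x * phiK K xs c x)).

Definition err2 (d N L : nat) (K : set {ffun 'I_d -> int}) (xs : 'I_N -> 'I_d -> R)
  (c : 'I_N -> R) (lg : 'I_d -> nat) (g : ('I_d -> R) -> R[i]) : R :=
  cabs (cint (fun x => g x * phiK K xs c x)
        - lattice_rule L lg (fun x => g x * phiK K xs c x)).

Definition mubar (N : nat) (c : 'I_N -> R) : R := (N%:R)^-1 * \sum_(n < N) `|c n|.

End Defs.

(* Main.v *)
Require Import Defs.
From HB Require Import structures.
From mathcomp Require Import all_boot all_order all_algebra.
From mathcomp Require Import all_classical all_reals all_analysis.
From mathcomp Require Import measurable_realfun complex ring lra zify.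
Set Implicit Arguments. Unset Strict Implicit. Unset Printing Implicit Defensive.
Import Order.TTheory GRing.Theory Num.Theory.
Import numFieldNormedType.Exports.
Local Open Scope classical_set_scope.
Local Open Scope ring_scope.
Local Open Scope complex_scope.

(** Write [a k] for the Fourier coefficients of [g], [S] for its norm in the
Wiener-type space, and [K] for the rectangle. Since [g] is the sum of its
absolutely convergent Fourier series, [(1/N) sum_n c_n g(x_n)] equals
[sum_k a_k phi_check_k], whereas the integral of [g phi_K] is the part of that
sum with [k] in [K]; outside [K] one has [1 <= sqrt (r_alpha k) / sqrt nu], and
[|phi_check_k| <= mubar], which bounds [err1] by [mubar * S / sqrt nu].

For [err2], [g phi_K] has Fourier coefficients
[b_k = sum_(h in K) phi_check_h a_(k+h)]. The Cauchy-Schwarz inequality with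
weights [sqrt (r_alpha (k+h))] gives
[|b_k|^2 <= mubar^2 * S * sum_h |a_(k+h)| / sqrt (r_alpha (k+h))], and summing
against [r_beta k] reduces the bound on [||g phi_K||_H] to the kernel estimate
[sum_(h in K) r_beta (m-h) <= nu^d c^2 (1 + 2 zeta(1+2 delta))^d r_alpha m].
The latter follows from [r_beta k = r_alpha k * |k|^-(1+2 delta)] for [k <> 0] in
one variable and [r_alpha (m-h) <= max(1, 2^(2 alpha) gamma) r_alpha m r_alpha h]. *)

(** * Iterated integration over the unit cube *)

Section cube_integral.
Context {R : realType}.
Local Notation mu := (@lebesgue_measure R).
Local Notation I01 := `[0%R : R, 1%R : R]%classic.

(** Follows the recursion of [cube_int]: every slice, and the function of slice integrals, must be
    integrable, so linearity holds layer by layer without appeal to Fubini. *)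
Fixpoint cube_integrable (d : nat) : (('I_d -> R) -> R) -> Prop :=
  match d return (('I_d -> R) -> R) -> Prop with
  | 0 => fun=> True
  | d'.+1 => fun f =>
      (forall t : R, 0 <= t <= 1 -> cube_integrable (fun y => f (ocons t y))) /\
      mu.-integrable I01 (EFin \o (fun t => cube_int (fun y => f (ocons t y))))
  end.

Lemma fine_mu01 : fine (mu I01) = 1.
Proof. by rewrite lebesgue_measure_itv /= lte_fin ltr01 oppr0 adde0. Qed.

Lemma integrable_cst01 (r : R) : mu.-integrable I01 (EFin \o cst r).
Proof.
apply: continuous_compact_integrable; first exact: segment_compact.
by apply: continuous_subspaceT => ?; exact: cst_continuous.
Qed.

Lemma unit_cube_ocons d (t : R) (y : 'I_d -> R) :
  0 <= t <= 1 -> unit_cube y -> unit_cube (ocons t y).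
Proof. by move=> t01 y01 i; rewrite /ocons; case: unliftP => [j _|_]. Qed.

Lemma cube_intD d (f g : ('I_d -> R) -> R) :
  cube_integrable f -> cube_integrable g ->
  cube_integrable (fun x => f x + g x) /\
  cube_int (fun x => f x + g x) = cube_int f + cube_int g.
Proof.
elim: d f g => [//|d IH] f g /= [fi fI] [gi gI].
have E t : t \in I01 -> cube_int (fun y => f (ocons t y) + g (ocons t y)) =
    cube_int (fun y => f (ocons t y)) + cube_int (fun y => g (ocons t y)).
  by rewrite inE /= in_itv /= => t01; exact: (IH _ _ (fi t t01) (gi t t01)).2.
split; [split|].
- by move=> t t01; exact: (IH _ _ (fi t t01) (gi t t01)).1.
- apply: eq_integrable (integrableD _ fI gI) => // t t01 /=.
  by rewrite E // EFinD.
- by rewrite -RintegralD //; exact: eq_Rintegral.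
Qed.

Lemma cube_intZ d (a : R) (f : ('I_d -> R) -> R) : cube_integrable f ->
  cube_integrable (fun x => a * f x) /\
  cube_int (fun x => a * f x) = a * cube_int f.
Proof.
elim: d f => [//|d IH] f /= [fi fI].
have E t : t \in I01 -> cube_int (fun y => a * f (ocons t y)) =
    a * cube_int (fun y => f (ocons t y)).
  by rewrite inE /= in_itv /= => t01; exact: (IH _ (fi t t01)).2.
split; [split|].
- by move=> t t01; exact: (IH _ (fi t t01)).1.
- apply: eq_integrable (integrableZl _ a fI) => // t t01 /=.
  by rewrite E // EFinM.
- by rewrite -RintegralZl //; exact: eq_Rintegral.
Qed.

(** [[0, 1]] has measure 1, so the bound [e] passes unchanged through each layer of the iterated
    integral. *)
Lemma cube_int_le d (e : R) (f g : ('I_d -> R) -> R) :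
  cube_integrable f -> cube_integrable g ->
  (forall x, unit_cube x -> `|f x - g x| <= e) -> `|cube_int f - cube_int g| <= e.
Proof.
elim: d f g => [|d IH] f g /=.
  by move=> _ _; apply => -[].
move=> [fi fI] [gi gI] fg.
have fgI : mu.-integrable I01 (EFin \o (fun t =>
    cube_int (fun y => f (ocons t y)) - cube_int (fun y => g (ocons t y)))).
  exact: eq_integrable (integrableB _ fI gI).
rewrite -RintegralB //; apply: le_trans (le_normr_Rintegral _ fgI) _ => //.
have -> : e = \int[mu]_(t in I01) e.
  by rewrite Rintegral_cst // fine_mu01 mulr1.
apply: le_Rintegral => //.
- by move/integrable_norm: fgI.
- exact: integrable_cst01.
- move=> t /=; rewrite in_itv /= => t01; apply: IH; [exact: fi|exact: gi|].
  by move=> y y01; apply: fg; exact: unit_cube_ocons.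
Qed.

(** The slice integrals [P n] of the approximants converge pointwise to those of [f], which gives
    measurability; [|P 0| + 1] is an integrable dominating function. *)
Lemma cube_integrable_uniform_lim d (f : ('I_d -> R) -> R) :
  (forall e : R, 0 < e -> exists2 p, cube_integrable p &
    forall x, unit_cube x -> `|p x - f x| <= e) -> cube_integrable f.
Proof.
elim: d f => [//|d IH] f /= fP.
have fi (t : R) : 0 <= t <= 1 -> cube_integrable (fun y => f (ocons t y)).
  move=> t01; apply: IH => e /fP [p [pi _] pf].
  exists (fun y => p (ocons t y)); first exact: pi.
  by move=> y y01; apply: pf; exact: unit_cube_ocons.
split => //.
have inv_gt0 n : 0 < n.+1%:R^-1 :> R by rewrite invr_gt0.
pose p n := projT1 (cid2 (fP _ (inv_gt0 n))).
have pi n : cube_integrable (p n) by rewrite /p; case: cid2.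
have pf n x : unit_cube x -> `|p n x - f x| <= n.+1%:R^-1.
  by rewrite /p; case: cid2 => /= q _; exact.
pose F t := cube_int (fun y => f (ocons t y)).
pose P n t := cube_int (fun y => p n (ocons t y)).
have PF n (t : R) : I01 t -> `|P n t - F t| <= n.+1%:R^-1.
  rewrite /= in_itv /= => t01; apply: cube_int_le; [exact: (pi n).1|exact: fi|].
  by move=> y y01; apply: pf; exact: unit_cube_ocons.
have PI n : mu.-integrable I01 (EFin \o P n) by exact: (pi n).2.
have mF : measurable_fun I01 F.
  apply: (@measurable_fun_cvg _ _ _ _ P) => [n|t t01].
    by apply/measurable_EFinP; exact: (measurable_int mu).
  apply/cvgrPdist_le => e e0; near=> n; rewrite distrC.
  apply: le_trans (PF n t t01) (ltW _); near: n.
  exact: (near_infty_natSinv_lt (PosNum e0)).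
have cI : mu.-integrable I01 (EFin \o cst (1 : R)).
  exact: integrable_cst01.
apply: le_integrable (integrableD _ (integrable_norm (PI 0%N)) cI) => //.
  by apply/measurable_EFinP.
move=> t t01 /=; rewrite lee_fin.
have := PF 0%N t t01; rewrite invr1 => PF0.
have -> : cube_int (fun y => f (ocons t y)) = P 0%N t - (P 0%N t - F t).
  by rewrite /F; ring.
rewrite [leRHS]ger0_norm ?addr_ge0 //.
by apply: le_trans (ler_normB _ _) _; rewrite lerD2l.
Unshelve. all: by end_near. Qed.

(** For [n != 0] the primitive [sin (w * t + th) / w] takes equal values at 0 and 1 by
    periodicity. *)
Lemma Rintegral_cos_int (n : int) (th : R) :
  \int[mu]_(t in I01) cos (2 * pi * (n%:~R * t) + th) =
  if n == 0 then cos th else 0.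
Proof.
case: eqP => [->|/eqP n0].
  under eq_Rintegral do rewrite mul0r mulr0 add0r.
  by rewrite Rintegral_cst // fine_mu01 mulr1.
have pi_neq0 : (pi : R) != 0 by rewrite gt_eqF // pi_gt0.
set w : R := 2 * pi * n%:~R.
have w0 : w != 0 by rewrite !mulf_neq0 // intr_eq0.
pose F t := w^-1 * sin (w * t + th).
have dF (t : R) : is_derive t (1 : R) F (cos (w * t + th)).
  rewrite /F; apply: is_derive_eq.
  by rewrite /GRing.scale /=; field.
rewrite /Rintegral.
under eq_integral do rewrite mulrA.
rewrite (@continuous_FTC2 _ _ F) //.
- rewrite /= /F mulr1 mulr0 add0r.
  have -> : sin (w + th) = sin th; last by rewrite subrr.
  have per (m : nat) (x : R) : sin (2 * pi * m%:R + x) = sin x.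
    by rewrite addrC mulr_natr [2 * _]mulr_natl (periodicn (@sinD2pi R)).
  rewrite /w; case: n {n0 w w0 F dF} => m; first by rewrite per.
  (* A negative frequency reduces to [per] applied at [th - 2 * pi * m.+1%:R]. *)
  rewrite NegzE mulrNz mulrN.
  by rewrite -[in RHS](subrK (2 * pi * m.+1%:R) th) [in RHS]addrC per addrC.
- apply: continuous_subspaceT => t.
  apply: continuous_comp; last exact: continuous_cos.
  by apply: cvgD; [apply: cvgM; [exact: cvg_cst|exact: cvg_id]|exact: cvg_cst].
- have cF (t : R) : {for t, continuous F}.
    by apply: differentiable_continuous; apply/derivable1_diffP; case: (dF t).
  split.
  + by move=> t _; case: (dF t).
  + by apply: cvg_at_right_filter; exact: cF.
  + by apply: cvg_at_left_filter; exact: cF.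
- by move=> t _; rewrite derive1E; case: (dF t).
Qed.

Lemma dotk_ocons d (k : {ffun 'I_d.+1 -> int}) (t : R) (y : 'I_d -> R) :
  dotk k (ocons t y) =
  (k ord0)%:~R * t + dotk [ffun j => k (lift ord0 j)] y.
Proof.
rewrite /dotk big_ord_recl {1}/ocons unlift_none; congr (_ + _).
by apply: eq_bigr => j _; rewrite ffunE /ocons liftK.
Qed.

Lemma ffun_ord_recl_eq0 d (k : {ffun 'I_d.+1 -> int}) :
  (k == 0) = (k ord0 == 0) && ([ffun j => k (lift ord0 j)] == 0).
Proof.
apply/eqP/andP => [->|[/eqP k0 /eqP /ffunP kS]].
  by rewrite !ffunE; split=> //; apply/eqP/ffunP => j; rewrite !ffunE.
apply/ffunP => j; rewrite ffunE; case: (unliftP ord0 j) => [i|] -> //.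
by have := kS i; rewrite !ffunE.
Qed.

(** The arbitrary phase [th] makes the induction work: for a fixed first coordinate [t], the
    contribution of [t] is absorbed into the phase. *)
Lemma cube_int_cos d (k : {ffun 'I_d -> int}) (th : R) :
  cube_integrable (fun x : 'I_d -> R => cos (2 * pi * dotk k x + th)) /\
  cube_int (fun x : 'I_d -> R => cos (2 * pi * dotk k x + th)) =
  if k == 0 then cos th else 0.
Proof.
elim: d k th => [|d IH] k th /=.
  split => //; rewrite /dotk big_ord0 mulr0 add0r.
  by have -> : k == 0 by apply/eqP/ffunP => -[].
set k' := [ffun j => k (lift ord0 j)].
have E t : (fun y : 'I_d -> R => cos (2 * pi * dotk k (ocons t y) + th)) =
    (fun y => cos (2 * pi * dotk k' y + (2 * pi * ((k ord0)%:~R * t) + th))).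
  by apply/funext => y; rewrite dotk_ocons; congr cos; rewrite -/k'; ring.
have I t : cube_int (fun y : 'I_d -> R => cos (2 * pi * dotk k (ocons t y) + th)) =
    if k' == 0 then cos (2 * pi * ((k ord0)%:~R * t) + th) else 0.
  by rewrite E; exact: (IH _ _).2.
rewrite ffun_ord_recl_eq0 -/k'; split; [split|].
- by move=> t _; rewrite E; exact: (IH _ _).1.
- rewrite (funext I); case: (k' == 0); last exact: integrable_cst01.
  apply: continuous_compact_integrable; first exact: segment_compact.
  apply: continuous_subspaceT => t.
  apply: continuous_comp; last exact: continuous_cos.
  apply: cvgD; last exact: cvg_cst.
  apply: cvgM; first exact: cvg_cst.
  by apply: cvgM; [exact: cvg_cst|exact: cvg_id].
- under eq_Rintegral do rewrite I.
  case: (k' == 0); rewrite ?andbT ?andbF; first exact: Rintegral_cos_int.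
  by rewrite Rintegral_cst // mul0r.
Qed.

(** Since [sin u = cos (u - pi / 2)], the cosine case applies, and its value at [k = 0],
    [cos (- (pi / 2))], vanishes. *)
Lemma cube_int_sin d (k : {ffun 'I_d -> int}) :
  cube_integrable (fun x : 'I_d -> R => sin (2 * pi * dotk k x)) /\
  cube_int (fun x : 'I_d -> R => sin (2 * pi * dotk k x)) = 0.
Proof.
have E : (fun x : 'I_d -> R => sin (2 * pi * dotk k x)) =
    (fun x => cos (2 * pi * dotk k x + - (pi / 2))).
  by apply/funext => x; rewrite -[in RHS]cosN opprD opprK cosDpihalf sinN opprK.
rewrite E; have [iI ->] := cube_int_cos k (- (pi / 2)); split=> //.
by rewrite cosN cos_pihalf if_same.
Qed.

End cube_integral.

(** * The modulus of a complex number *)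

Section modulus.
Context {R : realType}.
Implicit Types z w : R[i].

Lemma cabsE z : cabs z = ComplexField.Normc.normc z.
Proof. by case: z. Qed.

Lemma cabs_ge0 z : 0 <= cabs z.
Proof. exact: sqrtr_ge0. Qed.

Lemma cabs0 : cabs (0 : R[i]) = 0.
Proof. by rewrite cabsE ComplexField.Normc.normc0. Qed.

Lemma cabsM z w : cabs (z * w) = cabs z * cabs w.
Proof. by rewrite !cabsE ComplexField.Normc.normcM. Qed.

Lemma cabsV z : cabs z^-1 = (cabs z)^-1.
Proof. by rewrite !cabsE ComplexField.Normc.normcV. Qed.

Lemma ler_cabsD z w : cabs (z + w) <= cabs z + cabs w.
Proof. by rewrite !cabsE; exact: le_normcD. Qed.

Lemma cabsN z : cabs (- z) = cabs z.
Proof. by rewrite !cabsE; exact: normcN. Qed.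

Lemma cabs_distC z w : cabs (z - w) = cabs (w - z).
Proof. by rewrite -cabsN opprB. Qed.

Lemma ler_cabs_sum (I : Type) (s : seq I) (P : pred I) (F : I -> R[i]) :
  cabs (\sum_(i <- s | P i) F i) <= \sum_(i <- s | P i) cabs (F i).
Proof.
elim/big_ind2: _ => [|x1 x2 y1 y2 h1 h2|//]; first by rewrite cabs0.
by apply: le_trans (ler_cabsD _ _) _; exact: lerD.
Qed.

Lemma cabs_real (r : R) : cabs r%:C = `|r|.
Proof. by rewrite /cabs /= expr0n addr0 sqrtr_sqr. Qed.

Lemma cabs_nat (n : nat) : cabs (n%:R : R[i]) = n%:R.
Proof.
have -> : (n%:R : R[i]) = (n%:R)%:C by rewrite rmorph_nat.
by rewrite cabs_real ger0_norm.
Qed.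

Lemma ler_Re_cabs z : `|complex.Re z| <= cabs z.
Proof. by rewrite -sqrtr_sqr ler_wsqrtr // lerDl sqr_ge0. Qed.

Lemma ler_Im_cabs z : `|complex.Im z| <= cabs z.
Proof. by rewrite -sqrtr_sqr ler_wsqrtr // lerDr sqr_ge0. Qed.

Lemma ler_cabs_ReIm z : cabs z <= `|complex.Re z| + `|complex.Im z|.
Proof.
rewrite -[leRHS]ger0_norm ?addr_ge0 // -sqrtr_sqr ler_wsqrtr //.
by rewrite sqrrD !real_normK ?num_real // -addrA lerD2l lerDr mulrn_wge0 ?mulr_ge0.
Qed.

End modulus.

(** * Additivity and modulus of the exponentials [omega] *)

Section characters.
Context {R : realType} {d : nat}.
Implicit Types (k h : {ffun 'I_d -> int}) (x : 'I_d -> R).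

Lemma dotkD k h x : dotk (k + h) x = dotk k x + dotk h x.
Proof.
rewrite /dotk -big_split /=; apply: eq_bigr => j _.
by rewrite ffunE rmorphD mulrDl.
Qed.

Lemma dotkN k x : dotk (- k) x = - dotk k x.
Proof.
rewrite /dotk -sumrN; apply: eq_bigr => j _.
by rewrite ffunE rmorphN mulNr.
Qed.

Lemma omegaD k h x : omega (k + h) x = omega k x * omega h x.
Proof.
rewrite /omega dotkD mulrDr cosD sinD; apply/eqP; rewrite eq_complex /=.
by apply/andP; split; apply/eqP; ring.
Qed.

Lemma omegaN k x : omega (- k) x = ((omega k x)^*)%R.
Proof. by rewrite /omega dotkN mulrN cosN sinN. Qed.

Lemma cabs_omega k x : cabs (omega k x) = 1.
Proof. by rewrite /cabs /= cos2Dsin2 sqrtr1. Qed.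

End characters.

(** * Uniform trigonometric series: operations and Fourier coefficients *)

Section trigonometric_series.
Context {R : realType} {d : nat}.
Local Notation freq := {ffun 'I_d -> int}.
Implicit Types (a b : freq -> R[i]) (f g : ('I_d -> R) -> R[i]).

Definition trig_poly a (J : seq freq) (x : 'I_d -> R) : R[i] :=
  \sum_(k <- J) a k * omega k x.

(* [f] is, uniformly on the cube, the unconditional sum of [a k * omega k] *)
Definition trig_series a f := forall e : R, 0 < e ->
  exists J0 : seq freq, forall J : seq freq, uniq J -> {subset J0 <= J} ->
  forall x, unit_cube x -> cabs (trig_poly a J x - f x) <= e.

Lemma trig_seriesZ (c : R[i]) a f : trig_series a f ->
  trig_series (fun k => c * a k) (fun x => c * f x).
Proof.
(* The tolerance [e / (cabs c + 1)] also covers [c = 0]. *)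
move=> af e e0; have c0 : 0 < cabs c + 1 by rewrite ltr_wpDl ?cabs_ge0.
have [J0 HJ] := af _ (divr_gt0 e0 c0); exists J0 => J uJ sJ x x01.
have -> : trig_poly (fun k => c * a k) J x - c * f x = c * (trig_poly a J x - f x).
  rewrite mulrBr /trig_poly big_distrr /=; congr (_ - _).
  by apply: eq_bigr => k _; rewrite mulrA.
rewrite cabsM; apply: le_trans (ler_wpM2l (cabs_ge0 c) (HJ J uJ sJ x x01)) _.
by rewrite mulrCA ger_pMr // ler_pdivrMr // mul1r lerDl.
Qed.

Lemma trig_seriesD a b f g : trig_series a f -> trig_series b g ->
  trig_series (fun k => a k + b k) (fun x => f x + g x).
Proof.
move=> af bg e e0; have e20 : 0 < e / 2 by rewrite divr_gt0.
have [J1 H1] := af _ e20; have [J2 H2] := bg _ e20.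
exists (J1 ++ J2) => J uJ sJ x x01.
have -> : trig_poly (fun k => a k + b k) J x - (f x + g x) =
    (trig_poly a J x - f x) + (trig_poly b J x - g x).
  rewrite addrACA -opprD; congr (_ - _).
  rewrite /trig_poly -big_split; apply: eq_bigr => k _; exact: mulrDl.
apply: le_trans (ler_cabsD _ _) _; rewrite [leRHS](splitr e) lerD //.
  by apply: H1 => // k kJ; apply: sJ; rewrite mem_cat kJ.
by apply: H2 => // k kJ; apply: sJ; rewrite mem_cat kJ orbT.
Qed.

Lemma trig_series_sum (I : Type) (s : seq I) (a_ : I -> freq -> R[i])
    (f_ : I -> ('I_d -> R) -> R[i]) :
  (forall i, trig_series (a_ i) (f_ i)) ->
  trig_series (fun k => \sum_(i <- s) a_ i k) (fun x => \sum_(i <- s) f_ i x).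
Proof.
move=> H; elim: s => [|i s IH].
  move=> e e0; exists [::] => J _ _ x _; rewrite big_nil subr0 /trig_poly.
  rewrite big1 ?cabs0 ?ltW // => k _; by rewrite big_nil mul0r.
have -> : (fun k => \sum_(j <- i :: s) a_ j k) =
    (fun k => a_ i k + \sum_(j <- s) a_ j k).
  by apply/funext => k; rewrite big_cons.
have -> : (fun x => \sum_(j <- i :: s) f_ j x) =
    (fun x => f_ i x + \sum_(j <- s) f_ j x).
  by apply/funext => x; rewrite big_cons.
exact: trig_seriesD.
Qed.

(** Multiplying by a conjugate exponential translates the frequencies by [h]; its modulus is 1, so
    the uniform error is unchanged. *)
Lemma trig_series_shift (h : freq) a f : trig_series a f ->
  trig_series (fun k => a (k + h)) (fun x => f x * (omega h x)^*).
Proof.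
move=> af e /af[J0 HJ]; exists [seq k - h | k <- J0] => J uJ sJ x x01.
have -> : trig_poly (fun k => a (k + h)) J x =
    trig_poly a [seq k + h | k <- J] x * (omega h x)^*.
  rewrite /trig_poly big_map mulr_suml; apply: eq_bigr => k _.
  by rewrite -omegaN -mulrA -omegaD addrK.
rewrite -mulrBl cabsM -omegaN cabs_omega mulr1; apply: HJ => //.
  by rewrite map_inj_uniq //; exact: addIr.
move=> k kJ; apply/mapP; exists (k - h); last by rewrite subrK.
by apply: sJ; apply: map_f.
Qed.

Lemma cube_int_trig_poly a J :
  cube_integrable (fun x : 'I_d -> R => complex.Re (trig_poly a J x)) /\
  cube_int (fun x : 'I_d -> R => complex.Re (trig_poly a J x)) =
  \sum_(k <- J | k == 0) complex.Re (a k).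
Proof.
elim: J => [|k J [iJ eJ]].
  under eq_fun do rewrite /trig_poly big_nil /=.
  rewrite big_nil.
  (* The zero function is treated as 0 times a cosine. *)
  have [i0 E0] := @cube_intZ R d 0 _ (cube_int_cos 0 0).1.
  have e0 : (fun x : 'I_d -> R => 0 * cos (2 * pi * dotk 0 x + 0)) = (fun=> 0) :> (_ -> R).
    by apply/funext => x; rewrite mul0r.
  by rewrite mul0r e0 in E0; rewrite e0 in i0.
have [ic Ec] := cube_int_cos k (0 : R).
have [isn Es] := @cube_int_sin R d k.
have [ic' Ec'] := cube_intZ (complex.Re (a k)) ic.
have [is' Es'] := cube_intZ (- complex.Im (a k)) isn.
have [i1 E1] := cube_intD ic' is'.
have [i2 E2] := cube_intD i1 iJ.
have -> : (fun x : 'I_d -> R => complex.Re (trig_poly a (k :: J) x)) = (fun x : 'I_d -> R =>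
    complex.Re (a k) * cos (2 * pi * dotk k x + 0) +
    - complex.Im (a k) * sin (2 * pi * dotk k x) + complex.Re (trig_poly a J x)).
  apply/funext => x; rewrite /trig_poly big_cons raddfD /= addr0 mulNr; congr (_ + _).
  by rewrite /omega; case: (a k).
split=> //; rewrite E2 E1 Ec' Es' Ec Es eJ big_cons cos0.
by case: ifP => _; rewrite !(mulr1, mulr0, addr0, add0r).
Qed.

(** Uniform approximation by trigonometric polynomials gives both the integrability of the real part
    and the value of its integral. Frequency 0 is put into each polynomial, so that the polynomial
    integrates to exactly [Re (a 0)]. *)
Lemma cube_int_Re_trig_series a f : trig_series a f ->
  cube_int (fun x => complex.Re (f x)) = complex.Re (a 0).
Proof.
move=> af.
have app (e : R) : 0 < e -> exists2 J, uniq J && (0 \in J) & forall x, unit_cube x ->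
    `|complex.Re (trig_poly a J x) - complex.Re (f x)| <= e.
  move=> /af[J0 HJ]; exists (undup (0 :: J0)) => [|x x01].
    by rewrite undup_uniq mem_undup mem_head.
  rewrite -raddfB; apply: le_trans (ler_Re_cabs _) _; apply: HJ => //.
    exact: undup_uniq.
  by move=> k kJ; rewrite mem_undup inE kJ orbT.
have fi : cube_integrable (fun x => complex.Re (f x)).
  apply: cube_integrable_uniform_lim => e /app[J _ HJ].
  by exists (fun x => complex.Re (trig_poly a J x)) => //; exact: (cube_int_trig_poly _ _).1.
apply/eqP; rewrite -subr_eq0 -normr_le0; apply/ler_addgt0Pl => e e0.
rewrite addr0; have [J /andP[uJ J0] HJ] := app e e0.
have [iJ EJ] := cube_int_trig_poly a J.
have -> : complex.Re (a 0) = cube_int (fun x => complex.Re (trig_poly a J x)).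
  by rewrite EJ -big_filter (filter_pred1_uniq uJ J0) big_seq1.
by rewrite distrC; exact: cube_int_le.
Qed.

(** The imaginary part of [f] is the real part of [- 'i * f], so the real case is used twice. *)
Lemma cint_trig_series a f : trig_series a f -> cint f = a 0.
Proof.
move=> af; rewrite /cint.
have ImE (z : R[i]) : complex.Im z = complex.Re (- 'i * z).
  by case: z => p q /=; ring.
under [X in _ +i* cube_int X]eq_fun do rewrite ImE.
rewrite (cube_int_Re_trig_series af) (cube_int_Re_trig_series (trig_seriesZ (- 'i) af)).
by rewrite -ImE; case: (a 0).
Qed.

(** Shifting by [k] moves the coefficient sought to frequency 0, where it is an integral. *)
Lemma fcoef_trig_series a f k : trig_series a f -> fcoef f k = a k.
Proof.
by move=> af; rewrite /fcoef (cint_trig_series (trig_series_shift k af)) add0r.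
Qed.

End trigonometric_series.

(** * Finite sums and tails of nonnegative summable families *)

Section summable_families.

Lemma big_uniq_subset (T : eqType) (V : nmodType) (J0 J : seq T) (F : T -> V) :
  uniq J0 -> uniq J -> {subset J0 <= J} ->
  \sum_(k <- J) F k = \sum_(k <- J0) F k + \sum_(k <- J | k \notin J0) F k.
Proof.
move=> uJ0 uJ sJ; rewrite (bigID (mem J0)) /=; congr (_ + _).
rewrite -big_filter; apply: perm_big; apply: uniq_perm => //.
  exact: filter_uniq.
by move=> k; rewrite mem_filter /= andb_idr //; exact: sJ.
Qed.

Lemma ler_sum_uniq_subset (T : eqType) (R : numDomainType) (J0 J : seq T) (F : T -> R) :
  (forall k, 0 <= F k) -> uniq J0 -> uniq J -> {subset J0 <= J} ->
  \sum_(k <- J0) F k <= \sum_(k <- J) F k.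
Proof.
by move=> F0 uJ0 uJ sJ; rewrite (big_uniq_subset F uJ0 uJ sJ) lerDl sumr_ge0.
Qed.

Context {R : realType} {T : choiceType}.
Variable f : T -> R.
Hypothesis f_ge0 : forall k, 0 <= f k.
Hypothesis f_fin : (\esum_(k in [set: T]) (f k)%:E < +oo)%E.

Let S := fine (\esum_(k in [set: T]) (f k)%:E).

Let esumE : (\esum_(k in [set: T]) (f k)%:E = S%:E)%E.
Proof.
by rewrite fineK // ge0_fin_numE // esum_ge0 // => k _; rewrite lee_fin.
Qed.

Lemma ler_sum_esum (J : seq T) : uniq J -> \sum_(k <- J) f k <= S.
Proof.
move=> uJ; rewrite -lee_fin -esumE -sumEFin.
by apply: esum_ge; exists [set` J] => //; rewrite fsbig_seq.
Qed.

(** Some finite [J0] comes within [e] of the supremum defining the sum; a list disjoint from [J0]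
    can then add at most [e]. *)
Lemma esum_tail (e : R) : 0 < e -> exists J0 : seq T, forall J, uniq J ->
  {in J, forall k, k \notin J0} -> \sum_(k <- J) f k <= e.
Proof.
move=> e0.
have Sfin : (\esum_(k in [set: T]) (f k)%:E)%E \is a fin_num by rewrite esumE.
have [_ [A [fA _] <-]] := ub_ereal_sup_adherent e0 Sfin.
rewrite -/(esum _ _) esumE fsbig_finite //= sumEFin -EFinB lte_fin.
set J0 := finmap.enum_fset _ => SA; exists J0 => J uJ dJ.
have uAJ : uniq (J0 ++ J).
  rewrite cat_uniq finmap.fset_uniq uJ andbT /=.
  by apply/hasPn => k /dJ.
have := ler_sum_esum uAJ; rewrite big_cat /= => SAJ.
by rewrite -(lerD2l (\sum_(k <- J0) f k)); apply: le_trans SAJ _; lra.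
Qed.

End summable_families.

(** * Frequency boxes as lists *)

Section boxes.
Context {d : nat}.
Local Notation freq := {ffun 'I_d -> int}.

(** The frequencies of [boxsum M] as a list, so that square partial sums are among the sums over
    lists used in [trig_series]. *)
Definition box (M : nat) : seq freq :=
  [seq [ffun j => (u j)%:Z - M%:Z] | u : {ffun 'I_d -> 'I_(2 * M).+1}].

Lemma box_uniq M : uniq (box M).
Proof.
rewrite map_inj_uniq ?enum_uniq // => u v /ffunP uv; apply/ffunP => j.
by have := uv j; rewrite !ffunE => /addIr [] /val_inj.
Qed.

Lemma boxsumE (R : realType) M (F : freq -> R[i]) :
  boxsum M F = \sum_(k <- box M) F k.
Proof. by rewrite /boxsum /box big_map big_enum. Qed.

Lemma mem_box M (k : freq) : (forall j, (`|k j| <= M)%N) -> k \in box M.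
Proof.
move=> kM; apply/mapP; exists [ffun j => inord (absz (k j + M%:Z))]; first exact: mem_enum.
apply/ffunP => j; rewrite !ffunE inordK;
  move: (k j : int) (kM j) => n; lia.
Qed.

Lemma subset_box (J : seq freq) :
  exists M0 : nat, forall M, (M0 <= M)%N -> {subset J <= box M}.
Proof.
exists (\max_(k <- J) \max_j `|k j|)%N => M MM k kJ; apply: mem_box => j.
apply: leq_trans MM; apply: leq_trans (leq_bigmax_seq _ kJ isT) => /=.
exact: (leq_bigmax j).
Qed.

End boxes.

(** * Square partial sums versus unconditional uniform sums *)

Section fourier_series.
Context {R : realType} {d : nat}.
Local Notation freq := {ffun 'I_d -> int}.
Implicit Types (a : freq -> R[i]) (f : ('I_d -> R) -> R[i]).

(** Boxes eventually contain any given finite [J0], so the square partial sums inherit the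
    unconditional convergence. *)
Lemma trig_series_fourier_rep a f : trig_series a f -> fourier_rep f.
Proof.
move=> af x x01.
have -> : (fun k => fcoef f k * omega k x) = (fun k => a k * omega k x).
  by apply/funext => k; rewrite (fcoef_trig_series _ af).
have cv (e : R) : 0 < e -> \forall M \near \oo,
    cabs (f x - boxsum M (fun k => a k * omega k x)) <= e.
  move=> /af[J0 HJ]; have [M0 sM] := subset_box J0; near=> M.
  rewrite cabs_distC boxsumE; apply: HJ => //; first exact: box_uniq.
  by apply: sM; near: M; exists M0.
by split; apply/cvgrPdist_le => e /cv; apply: filterS => M;
  apply: le_trans; rewrite -raddfB; [exact: ler_Re_cabs|exact: ler_Im_cabs].
Unshelve. all: by end_near. Qed.

(* A partial sum over a large finite set [J] is compared with a box sum over a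
   box containing [J] that is chosen depending on the point: only the tail of
   the coefficients enters, hence the uniformity. *)
Lemma fourier_rep_trig_series f :
  (\esum_(k in [set: freq]) (cabs (fcoef f k))%:E < +oo)%E ->
  fourier_rep f -> trig_series (fcoef f) f.
Proof.
move=> fin fr e e0; have e20 : 0 < e / 2 by rewrite divr_gt0.
have [J0 HJ0] := esum_tail (fun k => cabs_ge0 _) fin e20.
exists J0 => J uJ sJ x x01; have [M0 sM] := subset_box J.
have e40 : 0 < e / 2 / 2 by rewrite divr_gt0.
have [/cvgrPdist_le/(_ _ e40) [M1 _ H1] /cvgrPdist_le/(_ _ e40) [M2 _ H2]] := fr x x01.
pose M := maxn M0 (maxn M1 M2).
have {}H1 := H1 M; have {}H2 := H2 M.
rewrite -!raddfB boxsumE in H1; rewrite -!raddfB boxsumE in H2.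
set B := \sum_(k <- _) _ in H1 H2.
have BfE : cabs (B - f x) <= e / 2.
  rewrite cabs_distC; apply: le_trans (ler_cabs_ReIm _) _.
  rewrite [leRHS]splitr lerD //; [apply: H1|apply: H2] => /=.
    by rewrite /M; lia.
  by rewrite /M; lia.
have BE : B = trig_poly (fcoef f) J x +
    \sum_(k <- box M | k \notin J) fcoef f k * omega k x.
  apply: big_uniq_subset => //; first exact: box_uniq.
  by apply: sM; rewrite /M leq_maxl.
set D := \sum_(k <- _ | _) _ in BE.
have DE : cabs D <= e / 2.
  apply: le_trans (ler_cabs_sum _ _ _) _.
  under eq_bigr do rewrite cabsM cabs_omega mulr1.
  rewrite -big_filter; apply: HJ0; first by rewrite filter_uniq ?box_uniq.
  by move=> k; rewrite mem_filter => /andP[kJ _]; apply: contra kJ; exact: sJ.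
have -> : trig_poly (fcoef f) J x - f x = (B - f x) - D by rewrite BE; ring.
by apply: le_trans (ler_cabsD _ _) _; rewrite cabsN [leRHS]splitr lerD.
Qed.

End fourier_series.

(** * Partial sums of the zeta series and their multivariate products *)

Section zeta_bound.
Context {R : realType}.

(* From [1 + t <= expR t] and [ln u <= u - 1], i.e. an elementary form of the
   comparison of the series with the integral of [x `^ (- s)]. *)
Lemma riemannR_telescope (s : R) (n : nat) : 1 < s ->
  riemannR s n.+1 <=
  (s - 1)^-1 * (n.+1%:R `^ (1 - s) - n.+2%:R `^ (1 - s)).
Proof.
move=> s1; set x : R := n.+1%:R; set y : R := n.+2%:R.
have x0 : 0 < x by rewrite ltr0n.
have y0 : 0 < y by rewrite ltr0n.
have yE : y = x + 1 by rewrite /y /x -natr1.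
rewrite (_ : riemannR s n.+1 = (y `^ s)^-1) // ler_pdivlMl ?subr_gt0 //.
have ys : (y `^ s)^-1 = y `^ (1 - s) / y.
  have -> : y `^ (1 - s) = y `^ 1 / y `^ s by rewrite powRB // (gt_eqF y0) implybT.
  by rewrite powRr1 ?ltW // mulrAC divff ?mul1r ?gt_eqF.
rewrite ys lerBrDr -[X in _ + X]mul1r mulrCA [X in _ <= X](_ : _ =
   y `^ (1 - s) * (y `^ (s - 1) * x `^ (1 - s))); last first.
  by rewrite mulrA -powRD ?(gt_eqF y0) ?implybT // (_ : 1 - s + (s - 1) = 0) ?powRr0 ?mul1r //; ring.
rewrite [1 * _]mulrC -mulrDr ler_pM2l ?powR_gt0 //.
rewrite /powR !gt_eqF // -expRD; apply: le_trans (expR_ge1Dx _).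
rewrite addrC lerD2l.
have -> : (s - 1) * ln y + (1 - s) * ln x = (s - 1) * (ln y - ln x) by ring.
rewrite ler_wpM2l ?subr_ge0 ?(ltW s1) // -ln_div ?posrE //.
have xyE : x / y = 1 - y^-1.
  have -> : x = y - 1 by rewrite yE addrK.
  by rewrite mulrBl mul1r divff // gt_eqF.
rewrite -[y / x]invf_div lnV ?posrE ?divr_gt0 // xyE.
rewrite lerNr; apply: le_ln1Dx.
by rewrite ltrN2 invf_lt1 // yE ltrDr.
Qed.

(** [zeta] is a [limn], so convergence must be established: telescoping bounds the partial sums by
    [1 + (s - 1)^-1]. *)
Lemma ler_series_zeta (s : R) (M : nat) : 1 < s ->
  \sum_(0 <= n < M) riemannR s n <= zeta s.
Proof.
move=> s1; have s0 : 0 <= s by apply: ltW; apply: lt_trans s1.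
have mono : nondecreasing_seq (series (riemannR s)).
  apply/nondecreasing_seqP => n; rewrite !seriesEnat /= big_nat_recr //= lerDl.
  exact/ltW/riemannR_gt0.
apply: (nondecreasing_cvgn_le mono); apply: nondecreasing_is_cvgn => //.
exists (1 + (s - 1)^-1) => _ [n _ <-].
have p0 : 0 <= (s - 1)^-1 by rewrite invr_ge0 subr_ge0 ltW.
(* With one more term the induction starts from the single term 1, where the telescoped part is
   0. *)
apply: le_trans (mono n n.+1 (leqnSn n)) _; rewrite seriesEnat /=.
apply: (@le_trans _ _ (1 + (s - 1)^-1 * (1 - n.+1%:R `^ (1 - s)))); last first.
  by rewrite lerD2l ler_piMr // gerBl powR_ge0.
elim: n => [|n IH]; first by rewrite big_nat1 /riemannR !powR1 invr1 subrr mulr0 addr0.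
rewrite big_nat_recr //=; apply: le_trans (lerD IH (riemannR_telescope n s1)) _.
by rewrite -addrA lerD2l -mulrDr addrA subrK.
Qed.

Lemma zeta_ge0 (s : R) : 1 < s -> 0 <= zeta s.
Proof. by move=> s1; have := ler_series_zeta 0 s1; rewrite big_geq. Qed.

(** For [s = 1 + 2 * delta] this is the one-variable ratio of [r_beta] to [r_alpha], equal to 1 at
    frequency 0. *)
Definition riemann_weight (s : R) (k : int) : R :=
  if k == 0 then 1 else (`|k|%:~R `^ s)^-1.

Lemma riemann_weight_ge0 s k : 0 <= riemann_weight s k.
Proof. by rewrite /riemann_weight; case: ifP => // _; rewrite invr_ge0 powR_ge0. Qed.

(** Passing from [M] to [M.+1] adds the end points [- M.+1] and [M.+1]; each contributes
    [riemannR s M], whose base is [M.+1]. *)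
Lemma sum_riemann_weight (s : R) (M : nat) :
  \sum_(0 <= i < (2 * M).+1) riemann_weight s (i%:Z - M%:Z) =
  1 + 2 * \sum_(0 <= n < M) riemannR s n.
Proof.
elim: M => [|M IH].
  by rewrite big_nat1 subrr /riemann_weight eqxx big_geq // mulr0 addr0.
rewrite (_ : (2 * M.+1).+1 = (2 * M).+3); last by lia.
rewrite big_nat_recr // big_nat_recl //= (_ : \sum_(0 <= i < (2 * M).+1) _ =
  \sum_(0 <= i < (2 * M).+1) riemann_weight s (i%:Z - M%:Z)); last first.
  by apply: eq_bigr => i _; congr riemann_weight; lia.
rewrite IH [in RHS]big_nat_recr //=.
rewrite (_ : 0%:Z - M.+1%:Z = - M.+1%:Z); last by lia.
rewrite (_ : ((2 * M).+2)%:Z - M.+1%:Z = M.+1%:Z); last by lia.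
rewrite /riemann_weight oppr_eq0 /= normrN ger0_norm //=.
rewrite (_ : riemannR s M = (M.+1%:~R `^ s)^-1) //; ring.
Qed.

(** Over a box containing [J] the sum of products factors into [d] one-variable sums, each at most
    [1 + 2 * zeta s]. *)
Lemma sum_riemann_weight_le d (s : R) (J : seq {ffun 'I_d -> int}) :
  1 < s -> uniq J ->
  \sum_(k <- J) \prod_j riemann_weight s (k j) <= (1 + 2 * zeta s) ^+ d.
Proof.
move=> s1 uJ; have [M0 /(_ M0 (leqnn _)) sM] := subset_box J.
apply: (@le_trans _ _ (\sum_(k <- box M0) \prod_j riemann_weight s (k j))).
  apply: ler_sum_uniq_subset => //; last exact: box_uniq.
  by move=> k; apply: prodr_ge0 => j _; exact: riemann_weight_ge0.
rewrite /box big_map big_enum /=.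
under eq_bigr => u _ do under eq_bigr => j _ do rewrite ffunE.
rewrite -(bigA_distr_bigA (fun (j : 'I_d) (i : 'I_(2 * M0).+1) =>
  riemann_weight s (i%:Z - M0%:Z))) /=.
rewrite prodr_const card_ord lerXn2r ?nnegrE //.
- by apply: sumr_ge0 => i _; exact: riemann_weight_ge0.
- by rewrite addr_ge0 // mulr_ge0 // zeta_ge0.
- rewrite -(big_mkord xpredT (fun i => riemann_weight s (i%:Z - M0%:Z))).
  by rewrite sum_riemann_weight lerD2l ler_pM2l // ler_series_zeta.
Qed.

End zeta_bound.

(** * The weights [r1] and [rprod], the rectangle and the kernel estimate *)

Section weights.
Context {R : realType}.
Implicit Types (alpha beta gam : R) (h m k : int).

Lemma norm_intr_ge1 h : h != 0 -> 1 <= `|h|%:~R :> R.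
Proof. by move=> h0; rewrite -[1]/(1%:~R) ler_int; move: h0; lia. Qed.

Lemma r1_ge1 beta gam h : 1 <= r1 beta gam h.
Proof. by rewrite /r1 le_max lexx orbT. Qed.

Lemma r1_0 beta gam : 0 < beta -> r1 beta gam 0 = 1.
Proof.
move=> b0; rewrite /r1 normr0 powR0 ?mul0r; last by rewrite mulf_neq0 // gt_eqF.
by rewrite max_r.
Qed.

Lemma r1_neq0 beta gam h : 0 <= beta -> 0 < gam <= 1 -> h != 0 ->
  r1 beta gam h = `|h|%:~R `^ (2 * beta) / gam.
Proof.
move=> b0 /andP[g0 g1] h0; rewrite /r1 max_l // ler_pdivlMr // mul1r.
apply: le_trans g1 _; rewrite -[leLHS](powRr0 (`|h|%:~R : R)).
by rewrite ler_powR ?norm_intr_ge1 // mulr_ge0.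
Qed.

(** For nonzero [m] and [h], [|m - h| <= |m| + |h| <= 2 |m| |h|], and writing [1 / gam] as
    [gam / gam ^ 2] produces the factor [gam]. The 1 in the maximum covers the cases where [m], [h]
    or [m - h] vanishes. *)
Lemma r1B alpha gam m h : 0 < alpha -> 0 < gam <= 1 ->
  r1 alpha gam (m - h) <=
  Num.max 1 (2 `^ (2 * alpha) * gam) * r1 alpha gam m * r1 alpha gam h.
Proof.
move=> a0 g01; set C := Num.max _ _.
have C1 : 1 <= C by rewrite le_max lexx.
have rC k : r1 alpha gam k <= C * r1 alpha gam k.
  by rewrite ler_peMl // (le_trans ler01) // r1_ge1.
have [->|h0] := eqVneq h 0; first by rewrite subr0 r1_0 // mulr1.
have [->|m0] := eqVneq m 0.
  by rewrite sub0r r1_0 // mulr1 {1}/r1 normrN -/(r1 _ _ _).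
have a20 : 0 <= 2 * alpha by rewrite mulr_ge0 // ltW.
have [mh|mh] := eqVneq (m - h) 0.
  by rewrite mh r1_0 // -mulrA !mulr_ege1 // r1_ge1.
rewrite !r1_neq0 ?(ltW a0) //; have /andP[g0 _] := g01.
apply: (@le_trans _ _ ((2 `^ (2 * alpha) * gam) * (`|m|%:~R `^ (2 * alpha) / gam) *
   (`|h|%:~R `^ (2 * alpha) / gam))); last first.
  rewrite -[leLHS]mulrA -[leRHS]mulrA ler_wpM2r ?mulr_ge0 ?powR_ge0 ?invr_ge0 ?(ltW g0) //.
  by rewrite le_max lexx orbT.
have -> : (2 `^ (2 * alpha) * gam) * (`|m|%:~R `^ (2 * alpha) / gam) *
   (`|h|%:~R `^ (2 * alpha) / gam) =
   (2 `^ (2 * alpha) * `|m|%:~R `^ (2 * alpha) * `|h|%:~R `^ (2 * alpha)) / gam.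
  by field; rewrite gt_eqF.
rewrite ler_wpM2r ?invr_ge0 ?(ltW g0) // -!powRM ?mulr_ge0 ?ler0z //.
rewrite ge0_ler_powR ?nnegrE ?mulr_ge0 ?ler0z ?(ltW a0) //.
have -> : 2 * `|m|%:~R * `|h|%:~R = (2 * `|m| * `|h|)%:~R :> R by rewrite !intrM.
rewrite ler_int.
apply: le_trans (ler_normB _ _) _.
have : 1 <= `|m| by move: m0; lia.
have : 1 <= `|h| by move: h0; lia.
move: `|m| `|h| => p q; nia.
Qed.

(** The exponents satisfy [2 * (alpha - 1/2 - delta) = 2 * alpha - (1 + 2 * delta)]. *)
Lemma r1_weight (alpha delta : R) gam k : 0 < alpha - 1/2 - delta -> 0 < alpha ->
  0 < gam <= 1 ->
  r1 (alpha - 1/2 - delta) gam k = r1 alpha gam k * riemann_weight (1 + 2 * delta) k.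
Proof.
move=> b0 a0 g01; rewrite /riemann_weight; case: eqVneq => [->|k0].
  by rewrite !r1_0 ?mulr1.
rewrite !r1_neq0 ?(ltW a0) ?(ltW b0) // mulrAC; congr (_ / _).
rewrite -powRB; first by congr (_ `^ _); lra.
by apply/implyP => _; rewrite gt_eqF // (lt_le_trans ltr01) // norm_intr_ge1.
Qed.

Context {d : nat}.
Variable gam : 'I_d -> R.
Hypothesis gam01 : forall j, 0 < gam j <= 1.
Local Notation freq := {ffun 'I_d -> int}.

Lemma r1_le_rprod alpha (k : freq) j : r1 alpha (gam j) (k j) <= rprod alpha gam k.
Proof.
rewrite /rprod (bigD1 j) //= ler_peMr ?(le_trans ler01 (r1_ge1 _ _ _)) //.
by elim/big_ind: _ => // [x y x1 y1|i _]; [rewrite mulr_ege1|exact: r1_ge1].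
Qed.

Lemma rprod_ge1 alpha (k : freq) : 1 <= rprod alpha gam k.
Proof.
by rewrite /rprod; elim/big_ind: _ => // [x y x1 y1|i _];
  [rewrite mulr_ege1|exact: r1_ge1].
Qed.

Lemma rprod_gt0 alpha (k : freq) : 0 < rprod alpha gam k.
Proof. exact: lt_le_trans ltr01 (rprod_ge1 _ _). Qed.

Lemma rprod_weight (alpha delta : R) (k : freq) :
  0 < alpha - 1/2 - delta -> 0 < alpha ->
  rprod (alpha - 1/2 - delta) gam k =
  rprod alpha gam k * \prod_j riemann_weight (1 + 2 * delta) (k j).
Proof.
move=> b0 a0; rewrite /rprod -big_split /=; apply: eq_bigr => j _.
exact: r1_weight.
Qed.

(** A nonzero coordinate [n] obeys [|n| <= |n| ^ (2 alpha) / gam <= nu], so the rectangle lies in a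
    box. *)
Lemma finite_wrect alpha nu : 1 < alpha -> finite_set (wrect alpha nu gam).
Proof.
move=> a1; apply: sub_finite_set (finite_seq (box (Num.bound nu))) => k /= kK.
apply: mem_box => j; have := kK j; have /andP[g0 g1] := gam01 j.
have [->//|k0] := eqVneq (k j) 0.
have a0 : 0 <= alpha by rewrite ltW // (lt_trans ltr01).
rewrite r1_neq0 // => knu.
have knu' : `|k j|%:~R <= nu.
  apply: le_trans knu; rewrite ler_pdivlMr //.
  apply: le_trans (le1r_powR (norm_intr_ge1 k0) _); last lra.
  by rewrite ler_piMr // ler0z.
have nu0 : 0 <= nu by apply: le_trans knu'; rewrite ler0z.
have := le_lt_trans knu' (archi_boundP nu0).
by rewrite -abszE -pmulrn ltr_nat => /ltnW.
Qed.

(** In each coordinate [r1B] costs one factor of the maximum, and membership in the rectangle costs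
    one factor [nu]. What remains is a sum of Riemann weights over the distinct frequencies
    [m - q]. *)
Lemma kernel_sum_le (alpha delta nu : R) (K : seq freq) (m : freq) :
  1 < alpha -> 0 < delta -> delta < alpha - 1 -> 0 <= nu ->
  uniq K -> {in K, forall q, wrect alpha nu gam q} ->
  \sum_(q <- K) rprod (alpha - 1/2 - delta) gam (m - q) <=
  nu ^+ d * (\prod_j Num.max 1 (2 `^ (2 * alpha) * gam j)) *
  (1 + 2 * zeta (1 + 2 * delta)) ^+ d * rprod alpha gam m.
Proof.
move=> a1 d0 da nu0 uK Knu.
set C := \prod_j _; set Z := (1 + 2 * zeta _) ^+ d.
have a0 : 0 < alpha by lra.
have C0 : 0 <= C.
  by apply: prodr_ge0 => j _; rewrite le_max ler01.
have step (h : freq) : h \in K -> rprod (alpha - 1/2 - delta) gam (m - h) <=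
    (nu ^+ d * C * rprod alpha gam m) *
    \prod_j riemann_weight (1 + 2 * delta) ((m - h) j).
  move=> hK; rewrite rprod_weight //; last lra.
  rewrite ler_wpM2r //.
    by apply: prodr_ge0 => j _; exact: riemann_weight_ge0.
  rewrite /rprod; have -> : nu ^+ d = \prod_(j < d) nu by rewrite prodr_const card_ord.
  rewrite -!big_split /=; apply: ler_prod => j _.
  rewrite (le_trans ler01 (r1_ge1 _ _ _)) /= !ffunE.
  apply: le_trans (r1B _ _ a0 (gam01 j)) _.
  rewrite -[leRHS]mulrA [leRHS]mulrC ler_wpM2l //; last exact: Knu.
  by apply: mulr_ge0; [rewrite le_max ler01|exact: le_trans (r1_ge1 _ _ _)].
rewrite [leRHS](_ : _ = (nu ^+ d * C * rprod alpha gam m) * Z); last by ring.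
apply: (@le_trans _ _ (\sum_(q <- K) (nu ^+ d * C * rprod alpha gam m) *
    \prod_j riemann_weight (1 + 2 * delta) ((m - q) j))).
  by rewrite big_seq [leRHS]big_seq; exact: ler_sum.
rewrite -mulr_sumr ler_wpM2l //.
  by rewrite !mulr_ge0 ?exprn_ge0 // ltW // rprod_gt0.
rewrite -(big_map (fun q => m - q) xpredT
  (fun k : freq => \prod_j riemann_weight (1 + 2 * delta) (k j))).
apply: sum_riemann_weight_le; first lra.
by rewrite map_inj_uniq // => q1 q2 /addrI /oppr_inj.
Qed.
End weights.

(** * Two elementary inequalities *)

Lemma ler_addgt0_mul (R : realFieldType) (A B m : R) : 0 <= m ->
  (forall e, 0 < e -> A <= B + e * m) -> A <= B.
Proof.
move=> m0 H; apply/ler_addgt0Pr => e e0.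
have m1 : 0 < m + 1 by rewrite ltr_wpDl.
apply: le_trans (H _ (divr_gt0 e0 m1)) _; rewrite lerD2l.
by rewrite mulrAC ler_pdivrMr // ler_pM2l // lerDl.
Qed.

(** Induction on the list: the new cross term needs [2 * X <= P / s i + Q * s i], which follows from
    [X ^ 2 <= P * Q] by the arithmetic-geometric mean inequality. *)
Lemma weighted_cauchy_schwarz (R : realFieldType) (I : Type) (K : seq I) (x s : I -> R) :
  (forall i, 0 <= x i) -> (forall i, 0 < s i) ->
  (\sum_(i <- K) x i) ^+ 2 <=
  (\sum_(i <- K) x i * s i) * (\sum_(i <- K) x i / s i).
Proof.
move=> x0 s0; elim: K => [|i K IH]; first by rewrite !big_nil expr0n mul0r.
rewrite !big_cons; move: IH.
have X0 : 0 <= \sum_(j <- K) x j by exact: sumr_ge0.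
have P0 : 0 <= \sum_(j <- K) x j * s j.
  by apply: sumr_ge0 => j _; rewrite mulr_ge0 // ltW.
have Q0 : 0 <= \sum_(j <- K) x j / s j.
  by apply: sumr_ge0 => j _; rewrite divr_ge0 // ltW.
move: (\sum_(j <- K) x j) (\sum_(j <- K) x j * s j) (\sum_(j <- K) x j / s j) X0 P0 Q0.
move=> X P Q X0 P0 Q0 IH.
have si0 := s0 i; have sn0 : s i != 0 by rewrite gt_eqF.
have key : 2 * X <= P / s i + Q * s i.
  rewrite -(@ler_pXn2r _ 2) ?nnegrE ?addr_ge0 ?mulr_ge0 ?invr_ge0 ?(ltW si0) //.
  apply: (@le_trans _ _ (4 * (P * Q))); first by rewrite exprMn; nra.
  rewrite -subr_ge0 (_ : _ - _ = (P / s i - Q * s i) ^+ 2) ?sqr_ge0 //.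
  by field.
have -> : (x i * s i + P) * (x i / s i + Q) =
    x i ^+ 2 + x i * (P / s i + Q * s i) + P * Q by field.
have := ler_wpM2l (x0 i) key; nra.
Qed.

(** * Weighted square norm of a finite convolution *)

Section convolution.
Context {R : realType} {d : nat}.
Local Notation freq := {ffun 'I_d -> int}.
Variables (K : seq freq) (w a : freq -> R[i]) (ra rb : freq -> R) (mu S V : R).
Hypothesis w_le : forall h, cabs (w h) <= mu.
Hypothesis ra_gt0 : forall k, 0 < ra k.
Hypothesis rb_ge0 : forall k, 0 <= rb k.
Hypothesis K_uniq : uniq K.
Hypothesis a_sum : forall J, uniq J ->
  \sum_(k <- J) Num.sqrt (ra k) * cabs (a k) <= S.
Hypothesis kernel : forall m, \sum_(h <- K) rb (m - h) <= V * ra m.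

Let s k := Num.sqrt (ra k).
Let s_gt0 k : 0 < s k. Proof. by rewrite sqrtr_gt0. Qed.
Let S_ge0 : 0 <= S. Proof. by have := @a_sum [::] isT; rewrite big_nil. Qed.
Let mu_ge0 : 0 <= mu. Proof. exact: le_trans (cabs_ge0 _) (w_le 0). Qed.
Let V_ge0 : 0 <= V.
Proof.
have : 0 <= V * ra 0 by apply: le_trans (kernel 0); exact: sumr_ge0.
by rewrite pmulr_lge0.
Qed.

(** Weighted Cauchy-Schwarz, whose first factor runs over the distinct frequencies [k + h] and is
    therefore at most [S]. *)
Lemma conv_coef_le k : cabs (\sum_(h <- K) w h * a (k + h)) ^+ 2 <=
  mu ^+ 2 * (S * \sum_(h <- K) cabs (a (k + h)) / s (k + h)).
Proof.
apply: (@le_trans _ _ ((mu * \sum_(h <- K) cabs (a (k + h))) ^+ 2)).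
  rewrite lerXn2r ?nnegrE ?cabs_ge0 ?mulr_ge0 //.
    by apply: sumr_ge0 => h _; exact: cabs_ge0.
  apply: le_trans (ler_cabs_sum _ _ _) _; rewrite mulr_sumr; apply: ler_sum => h _.
  by rewrite cabsM ler_wpM2r ?cabs_ge0.
rewrite exprMn ler_wpM2l ?sqr_ge0 //.
apply: le_trans (weighted_cauchy_schwarz K (fun h => cabs_ge0 (a (k + h)))
  (fun h => s_gt0 (k + h))) _.
rewrite ler_wpM2r //.
  by apply: sumr_ge0 => h _; rewrite divr_ge0 ?cabs_ge0 // ltW.
have uK : uniq [seq k + h | h <- K] by rewrite map_inj_uniq //; exact: addrI.
have := a_sum uK; rewrite big_map; apply: le_trans.
by apply: ler_sum => h _; rewrite mulrC.
Qed.

(** After the substitution [m = k + h] and an exchange of sums, [kernel] bounds the inner sum by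
    [V * ra m], and [ra m / s m = s m] restores the summand controlled by [a_sum]. *)
Lemma conv_norm2_le (F : seq freq) : uniq F ->
  \sum_(k <- F) rb k * cabs (\sum_(h <- K) w h * a (k + h)) ^+ 2 <=
  V * (mu * S) ^+ 2.
Proof.
(* [J] collects all [k + h]: a range for [m] independent of [h] is what permits the exchange. *)
move=> uF; pose J := undup [seq k + h | k <- F, h <- K].
pose G h m := rb (m - h) * (cabs (a m) / s m).
have G0 h m : 0 <= G h m by rewrite mulr_ge0 // divr_ge0 ?cabs_ge0 // ltW.
apply: (@le_trans _ _ (mu ^+ 2 * S * \sum_(k <- F) \sum_(h <- K) G h (k + h))).
  rewrite mulr_sumr; apply: ler_sum => k _.
  apply: le_trans (ler_wpM2l (rb_ge0 k) (conv_coef_le k)) _.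
  rewrite le_eqVlt; apply/orP; left; apply/eqP.
  have -> : \sum_(h <- K) G h (k + h) =
      rb k * \sum_(h <- K) cabs (a (k + h)) / s (k + h).
    by rewrite mulr_sumr; apply: eq_bigr => h _; rewrite /G addrK.
  by ring.
rewrite exprMn (_ : V * _ = mu ^+ 2 * S * (V * S)); last by ring.
rewrite ler_wpM2l ?mulr_ge0 ?sqr_ge0 // exchange_big /=.
apply: (@le_trans _ _ (\sum_(h <- K) \sum_(m <- J) G h m)).
  rewrite big_seq [leRHS]big_seq; apply: ler_sum => h hK.
  rewrite -(big_map (fun k => k + h) xpredT (G h)).
  apply: ler_sum_uniq_subset => //; last 2 first.
  - exact: undup_uniq.
  - move=> _ /mapP[k kF ->]; rewrite mem_undup.
    by apply/allpairsP; exists (k, h).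
  - by rewrite map_inj_uniq //; exact: addIr.
rewrite exchange_big /= ; apply: (@le_trans _ _ (\sum_(m <- J) V * (s m * cabs (a m)))).
  apply: ler_sum => m _; rewrite -mulr_suml.
  have sm : s m * s m = ra m by rewrite -expr2 sqr_sqrtr // ltW.
  apply: le_trans (ler_wpM2r _ (kernel m)) _.
    by rewrite divr_ge0 ?cabs_ge0 // ltW.
  have sn0 : s m != 0 by rewrite gt_eqF.
  by rewrite -sm le_eqVlt; apply/orP; left; apply/eqP; field.
by rewrite -mulr_sumr ler_wpM2l // a_sum // undup_uniq.
Qed.

End convolution.

(** * The product of [g] with [phiK] and the compression error *)

Section compression.
Context {R : realType} {d N : nat}.
Local Notation freq := {ffun 'I_d -> int}.
Variables (xs : 'I_N -> 'I_d -> R) (c : 'I_N -> R).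

Lemma cabs_phi_check k : cabs (phi_check xs c k) <= mubar c.
Proof.
rewrite /phi_check /mubar cabsM cabsV cabs_nat ler_wpM2l ?invr_ge0 //.
apply: le_trans (ler_cabs_sum _ _ _) _; apply: ler_sum => n _.
by rewrite cabsM cabs_omega mulr1 cabs_real.
Qed.

Lemma mubar_ge0 : 0 <= mubar c.
Proof. by rewrite mulr_ge0 ?invr_ge0 // sumr_ge0. Qed.

Variables (a : freq -> R[i]) (g : ('I_d -> R) -> R[i]).
Hypothesis ag : trig_series a g.
Variable K : set freq.
Hypothesis K_fin : finite_set K.
Let Ks : seq freq := finmap.enum_fset (fset_set K).

Definition phiK_coef k := \sum_(h <- Ks) phi_check xs c h * a (k + h).

Lemma trig_series_phiK : trig_series phiK_coef (fun x => g x * phiK K xs c x).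
Proof.
have -> : (fun x => g x * phiK K xs c x) =
    (fun x => \sum_(h <- Ks) phi_check xs c h * (g x * ((omega h x)^*)%R)).
  apply/funext => x; rewrite /phiK fsbig_finite // mulr_sumr.
  by apply: eq_bigr => h _; rewrite mulrCA.
apply: trig_series_sum => h; apply: trig_seriesZ; exact: trig_series_shift.
Qed.

Lemma err1_le (r : R) : (forall n, unit_cube (xs n)) ->
  (forall J : seq freq, uniq J -> {in J, forall k, ~ K k} ->
    \sum_(k <- J) cabs (a k) <= r) ->
  err1 K xs c g <= r * mubar c.
Proof.
move=> xs01 tail; rewrite /err1 (cint_trig_series trig_series_phiK).
apply: (ler_addgt0_mul mubar_ge0) => e /ag[J0 HJ].
(* [J] contains [J0], to approximate [g] at the nodes within [e], and [Ks], to cancel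
   [phiK_coef 0]. *)
pose J := undup (J0 ++ Ks).
have uJ : uniq J by exact: undup_uniq.
have {}HJ n : cabs (g (xs n) - trig_poly a J (xs n)) <= e.
  rewrite cabs_distC; apply: HJ => // k kJ; by rewrite mem_undup mem_cat kJ.
have KJ : {subset Ks <= J} by move=> k kK; rewrite mem_undup mem_cat kK orbT.
have E : N%:R^-1 * \sum_(n < N) (c n)%:C * g (xs n) - phiK_coef 0 =
    \sum_(k <- J | k \notin Ks) phi_check xs c k * a k +
    N%:R^-1 * \sum_(n < N) (c n)%:C * (g (xs n) - trig_poly a J (xs n)).
  have -> : phiK_coef 0 = \sum_(k <- Ks) phi_check xs c k * a k.
    by apply: eq_bigr => k _; rewrite add0r.
  have JE : \sum_(k <- J) phi_check xs c k * a k =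
      N%:R^-1 * \sum_(n < N) (c n)%:C * trig_poly a J (xs n).
    under eq_bigr => k _ do rewrite /phi_check -mulrA mulr_suml.
    rewrite -mulr_sumr exchange_big /=; congr (_ * _); apply: eq_bigr => n _.
    by rewrite /trig_poly mulr_sumr; apply: eq_bigr => k _; ring.
  have -> : N%:R^-1 * \sum_(n < N) (c n)%:C * g (xs n) =
      \sum_(k <- J) phi_check xs c k * a k +
      N%:R^-1 * \sum_(n < N) (c n)%:C * (g (xs n) - trig_poly a J (xs n)).
    rewrite JE -mulrDr -big_split /=; congr (_ * _); apply: eq_bigr => n _.
    by rewrite -mulrDr addrC subrK.
  rewrite (big_uniq_subset _ (finmap.fset_uniq _) uJ KJ) -/Ks.
  by rewrite addrAC (addrC (\sum_(k <- Ks) _)) addrK.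
rewrite E; apply: le_trans (ler_cabsD _ _) _; apply: lerD.
  apply: le_trans (ler_cabs_sum _ _ _) _.
  apply: (@le_trans _ _ (mubar c * \sum_(k <- J | k \notin Ks) cabs (a k))).
    rewrite mulr_sumr; apply: ler_sum => k _.
    by rewrite cabsM ler_wpM2r ?cabs_ge0 ?cabs_phi_check.
  rewrite mulrC ler_wpM2r ?mubar_ge0 // -big_filter; apply: tail.
    by rewrite filter_uniq.
  move=> k; rewrite mem_filter => /andP[kK _] Kk; move: kK.
  by rewrite /Ks in_fset_set // mem_set.
rewrite cabsM cabsV cabs_nat /mubar mulrCA ler_wpM2l ?invr_ge0 //.
apply: le_trans (ler_cabs_sum _ _ _) _; rewrite mulr_sumr; apply: ler_sum => n _.
by rewrite cabsM cabs_real mulrC ler_wpM2r.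
Qed.

End compression.

(** * From the worst-case error to the error of a single function *)

Section lattice_error.
Context {R : realType} {d : nat}.

(** Scaling by [1 / (B + e)] puts [f] in the unit ball; [e > 0] keeps the divisor positive when
    [B = 0] and is finally removed by a limit. *)
Lemma wce_bound (beta B C : R) (gam : 'I_d -> R) (L : nat) (lg : 'I_d -> nat)
    (b : {ffun 'I_d -> int} -> R[i]) (f : ('I_d -> R) -> R[i]) :
  0 <= B -> trig_series b f ->
  (forall F : seq {ffun 'I_d -> int}, uniq F ->
    \sum_(k <- F) rprod beta gam k * cabs (b k) ^+ 2 <= B ^+ 2) ->
  (wce beta gam L lg <= C%:E)%E ->
  cabs (cint f - lattice_rule L lg f) <= C * B.
Proof.
move=> B0 bf bB wC.
have scaled (e : R) : 0 < e -> cabs (cint f - lattice_rule L lg f) <= C * (B + e).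
  move=> e0; have D0 : 0 < B + e by rewrite ltr_wpDl.
  pose q : R[i] := ((B + e)^-1)%:C.
  have cq : cabs q = (B + e)^-1 by rewrite cabs_real ger0_norm // invr_ge0 ltW.
  have qf := trig_seriesZ q bf.
  have -> : cabs (cint f - lattice_rule L lg f) =
      cabs (cint (fun x => q * f x) - lattice_rule L lg (fun x => q * f x)) * (B + e).
    rewrite (cint_trig_series qf) (cint_trig_series bf) /lattice_rule -mulr_sumr.
    by rewrite mulrCA -mulrBr cabsM cq mulrAC mulVf ?mul1r // gt_eqF.
  rewrite ler_pM2r // -lee_fin; apply: le_trans wC; apply: ereal_sup_ubound.
  exists (fun x => q * f x) => //; split; last exact: trig_series_fourier_rep qf.
  apply: ge_ereal_sup => _ [A [fA _] <-]; rewrite fsbig_finite //= sumEFin lee_fin.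
  under eq_bigr => k _ do rewrite (fcoef_trig_series k qf) cabsM cq exprMn mulrCA.
  rewrite -mulr_sumr exprVn ler_pdivrMl ?exprn_gt0 // mulr1.
  apply: le_trans (bB _ (finmap.fset_uniq _)) _.
  by rewrite lerXn2r ?nnegrE ?(ltW D0) // lerDl ltW.
(* A modulus is at most [C * (B + 1)], which forces the sign of [C]. *)
have C0 : 0 <= C.
  have := scaled 1 ltr01; have := cabs_ge0 (cint f - lattice_rule L lg f).
  by move=> /le_trans /[apply]; rewrite pmulr_lge0 // ltr_wpDl.
apply: (ler_addgt0_mul C0) => e e0; by rewrite [e * C]mulrC -mulrDr scaled.
Qed.

End lattice_error.

(** * Assembly of the two error bounds *)

Theorem theorem3p13 (R : realType) (alpha delta tau : R) (d : nat)
  (gam : 'I_d -> R) (g : ('I_d -> R) -> R[i])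
  (N : nat) (xs : 'I_N -> 'I_d -> R) (c : 'I_N -> R)
  (L : nat) (lg : 'I_d -> nat) (nu : R) :
  1 < alpha ->
  0 < delta -> delta < alpha - 1 ->
  0 < tau -> tau <= alpha - 1 - delta ->
  (0 < d)%N ->
  (forall j, 0 < gam j <= 1) ->
  (forall i j : 'I_d, (i <= j)%N -> gam j <= gam i) ->
  (Anorm alpha gam g < +oo)%E ->
  fourier_rep g ->
  (0 < N)%N ->
  (forall n, unit_cube (xs n)) ->
  prime L ->
  (forall j, (0 < lg j < L)%N) ->
  (forall tau' : R, 0 < tau' -> tau' <= (alpha - 1/2 - delta) - 1/2 ->
     (wce (alpha - 1/2 - delta) gam L lg
       <= (Cgd gam (alpha - 1/2 - delta) tau'
           * L%:R `^ (- (alpha - 1/2 - delta) + tau'))%:E)%E) ->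
  1 < nu ->
  cabs ((N%:R)^-1 * \sum_(n < N) (c n)%:C * g (xs n)
        - lattice_rule L lg (fun x => g x * phiK (wrect alpha nu gam) xs c x))
    <= err1 (wrect alpha nu gam) xs c g + err2 L (wrect alpha nu gam) xs c lg g
  /\
  err1 (wrect alpha nu gam) xs c g + err2 L (wrect alpha nu gam) xs c lg g
    <= fine (Anorm alpha gam g)
       * ((Num.sqrt nu)^-1
          + nu `^ (d%:R / 2) / L%:R `^ (alpha - 1/2 - delta - tau)
            * c_agd alpha gam * zeta_dd d delta * Cgd gam (alpha - 1/2 - delta) tau)
       * mubar c.
Proof.
move=> a1 d0 da t0 ta _ gam01 _ Afin grep _ xs01 _ _ wceC nu1; split.
  rewrite /err1 /err2 [X in cabs X](_ : _ =
    (N%:R^-1 * \sum_(n < N) (c n)%:C * g (xs n)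
      - cint (fun x => g x * phiK (wrect alpha nu gam) xs c x)) +
    (cint (fun x => g x * phiK (wrect alpha nu gam) xs c x)
      - lattice_rule L lg (fun x => g x * phiK (wrect alpha nu gam) xs c x)));
    last by rewrite addrA subrK.
  exact: ler_cabsD.
set K := wrect alpha nu gam; set beta := alpha - 1/2 - delta.
set S := fine (Anorm alpha gam g); set mu := mubar c.
have nu0 : 0 < nu by exact: lt_trans nu1.
have wg_ge0 k : 0 <= Num.sqrt (rprod alpha gam k) * cabs (fcoef g k).
  by rewrite mulr_ge0 ?sqrtr_ge0 ?cabs_ge0.
have Ssum J : uniq J ->
    \sum_(k <- J) Num.sqrt (rprod alpha gam k) * cabs (fcoef g k) <= S.
  exact: ler_sum_esum wg_ge0 Afin J.
have S0 : 0 <= S by have := Ssum [::] isT; rewrite big_nil.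
have mu0 : 0 <= mu by exact: mubar_ge0.
have sqrt_ge1 k : 1 <= Num.sqrt (rprod alpha gam k).
  by rewrite -[leLHS]sqrtr1 ler_wsqrtr // rprod_ge1.
(* The weights are at least 1, so the coefficients are absolutely summable and [g] is the uniform
   sum of its series. *)
have afin : (\esum_(k in [set: {ffun 'I_d -> int}]) (cabs (fcoef g k))%:E < +oo)%E.
  apply: le_lt_trans Afin; apply: le_esum => k _.
  by rewrite lee_fin ler_peMl ?cabs_ge0.
have ag := fourier_rep_trig_series afin grep.
have finK : finite_set K by exact: finite_wrect.
have e1 : err1 K xs c g <= (Num.sqrt nu)^-1 * S * mu.
  apply: (err1_le c ag finK xs01) => J uJ JK.
  rewrite ler_pdivlMl ?sqrtr_gt0 // mulr_sumr; apply: le_trans (Ssum J uJ).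
  rewrite big_seq [leRHS]big_seq; apply: ler_sum => k /JK kK.
  rewrite ler_wpM2r ?cabs_ge0 // ler_wsqrtr //.
  (* Outside [K] some coordinate has [r1 > nu], and [rprod] dominates each of its factors. *)
  have /existsNP[j /negP] := kK; rewrite -ltNge => /ltW /le_trans; apply.
  exact: r1_le_rprod.
set Z := 1 + 2 * zeta (1 + 2 * delta).
have Z0 : 0 <= Z by rewrite addr_ge0 // mulr_ge0 // zeta_ge0; lra.
(* The square root of the constant in [kernel_sum_le]; [V * (mu * S)] will bound the norm of
   [g * phiK]. *)
set V := nu `^ (d%:R / 2) * c_agd alpha gam * zeta_dd d delta.
have V0 : 0 <= V by rewrite !mulr_ge0 ?powR_ge0 ?sqrtr_ge0.
have V2 : V ^+ 2 =
    nu ^+ d * (\prod_j Num.max 1 (2 `^ (2 * alpha) * gam j)) * Z ^+ d.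
  have half (x : R) : 0 <= x -> (x `^ (d%:R / 2)) ^+ 2 = x ^+ d.
    move=> x0; rewrite -powR_mulrn ?powR_ge0 // -powRrM mulfVK ?powR_mulrn //.
  rewrite /V !exprMn half ?(ltW nu0) // half // sqr_sqrtr //.
  by apply: prodr_ge0 => j _; rewrite le_max ler01.
(* The bound [tau <= alpha - 1 - delta] is exactly the range allowed for [tau'] in the lattice
   hypothesis. *)
have tb : tau <= beta - 1/2 by rewrite /beta; lra.
have e2 : err2 L K xs c lg g <=
    Cgd gam beta tau * L%:R `^ (- beta + tau) * (V * (mu * S)).
  apply: (wce_bound _ (trig_series_phiK xs c ag finK) _ (wceC tau t0 tb)).
    by apply: mulr_ge0 => //; exact: mulr_ge0.
  move=> F uF; rewrite [leRHS]exprMn.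
  apply: (conv_norm2_le (cabs_phi_check xs c) (rprod_gt0 gam alpha)) => //.
  - by move=> k; exact/ltW/rprod_gt0.
  - exact: finmap.fset_uniq.
  - move=> m; rewrite V2; apply: kernel_sum_le => //; first exact: ltW.
      exact: finmap.fset_uniq.
    by move=> h; rewrite in_fset_set // inE.
apply: le_trans (lerD e1 e2) _; rewrite le_eqVlt; apply/orP; left; apply/eqP.
have -> : - beta + tau = - (alpha - 1/2 - delta - tau) by rewrite /beta; ring.
by rewrite powRN /V; ring.
Qed.
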